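(* Let $A$ be the adjacency matrix of the Paley graph $\mathcal{P}_{13}$ of order $13$ and let $\omega$ be a primitive $13$th root of $1$ in $\mathbb{C}$. For every integer $k\ge0$ and every $c\in\{0,1,\dots,12\}$, the number of walks of $k$ steps from $0$ to $c$ on $\mathcal{P}_{13}$ is $$(A^k)_{0,c}=\frac1{13}\sum_{\substack{0\le\ell_1,\dots,\ell_6\le k\\ \ell_1+\ell_2+\cdots+\ell_6=k}}\binom{k}{\ell_1,\ell_2,\dots,\ell_6}\left(\sum_{b=0}^{12}\omega^{(\ell_1+3\ell_2+4\ell_3+9\ell_4+10\ell_5+12\ell_6-c)b}\right)=\sum\binom{k}{\ell_1,\ell_2,\dots,\ell_6},$$ where the last sum is over all $0\le\ell_1,\dots,\ell_6\le k$ with $\ell_1+\ell_2+\cdots+\ell_6=k$ and $\ell_1+3\ell_2+4\ell_3+9\ell_4+10\ell_5+12\ell_6\equiv c \bmod 13$.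
   Context: The Paley graph $\mathcal{P}_{13}$ has node set $\mathbb{Z}_{13}=\{0,1,\dots,12\}$, with an edge between $a$ and $b$ if and only if $b-a$ is a nonzero square modulo $13$, i.e. $b-a\in\{1,3,4,9,10,12\}$ modulo $13$. $\binom{k}{\ell_1,\dots,\ell_6}=\frac{k!}{\ell_1!\cdots\ell_6!}$ is the multinomial coefficient. *)

(* Defs.v *)
From HB Require Import structures.
From mathcomp Require Import all_boot all_order all_algebra.
From mathcomp Require Import reals.
From mathcomp Require Export complex.

Set Implicit Arguments.
Unset Strict Implicit.
Unset Printing Implicit Defensive.

Import GRing.Theory.
Local Open Scope ring_scope.

(* 'Z_13 is convertible to 'I_13, so it also serves as a matrix index type. *)
Definition paley13 : rel 'Z_13 :=
  [rel a b | (b - a != 0) && [exists x : 'Z_13, b - a == x ^+ 2]].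

Definition adjmx (R : pzSemiRingType) (n : nat) (e : rel 'I_n) : 'M[R]_n :=
  \matrix_(i, j) (e i j)%:R.

(* A walk of k steps from u to v is encoded by its k vertices after u. *)
Definition walks (T : finType) (e : rel T) (k : nat) (u v : T) :
    {set k.-tuple T} :=
  [set w : k.-tuple T | path e u w && (last u w == v)].

(* Only meaningful when the l i sum to k; the division is then exact. *)
Definition multinomial (n k : nat) (l : 'I_n -> nat) : nat :=
  (k`! %/ \prod_(i < n) (l i)`!)%N.

Definition residues13 : 6.-tuple nat := [tuple 1; 3; 4; 9; 10; 12]%N.

Definition weight13 (l : 'I_6 -> nat) : nat :=
  (\sum_(i < 6) tnth residues13 i * l i)%N.

Lemma paley13E (a b : 'Z_13) :
  paley13 a b = (val (b - a)%R \in (residues13 : seq nat)).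
Proof.
rewrite /paley13 -[LHS]/((b - a != 0) && [exists x : 'Z_13, b - a == x ^+ 2]).
move: (b - a) => d.
have [|nsq] := boolP [exists x, d == x ^+ 2].
  case/existsP=> x /eqP ->; rewrite andbT.
  by case: x => -[|[|[|[|[|[|[|[|[|[|[|[|[|m]]]]]]]]]]]]].
rewrite andbF; apply/esym/negP => dR; case/negP: nsq; apply/existsP.
have sq (x : 'Z_13) : val d = val (x ^+ 2) -> exists y : 'Z_13, d == y ^+ 2.
  by move=> /val_inj ->; exists x.
by move: dR; rewrite !inE => /or4P[|||/or3P[||]] /eqP dE;
  [apply: (sq 1) | apply: (sq 4%:R) | apply: (sq 2%:R)
  | apply: (sq 3%:R) | apply: (sq 6%:R) | apply: (sq 5%:R)]; rewrite dE.
Qed.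

(* Main.v *)
Require Import Defs.
From HB Require Import structures.
From mathcomp Require Import all_boot all_order all_algebra.
From mathcomp Require Import reals complex.

Set Implicit Arguments.
Unset Strict Implicit.
Unset Printing Implicit Defensive.

Import GRing.Theory.
Local Open Scope ring_scope.

(* The additive characters of Z/13 diagonalize the adjacency matrix: with
   lambda_b = sum_r omega^(r b) over the six residues r, the orthogonality of
   characters gives (A^k)_{u,c} = 1/13 sum_b omega^((u-c) b) lambda_b^k.  The
   middle formula is the multinomial expansion of lambda_b^k, and the last one
   is orthogonality again, applied to each term of that expansion. *)

(** Since the encoding omits the start, the head of a nonempty tuple is the vertex reached by the
    first step, and its tail encodes a walk from there. *)
Lemma card_walksS (T : finType) (e : rel T) (k : nat) (u v : T) :
  #|walks e k.+1 u v| = (\sum_w e u w * #|walks e k w v|)%N.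
Proof.
have cons_bij : bijective (fun p : T * k.-tuple T => [tuple of p.1 :: p.2]).
  exists (fun t => (thead t, [tuple of behead t])) => [[w t]|t] /=.
    by rewrite theadE; congr pair; apply: val_inj.
  by rewrite -tuple_eta.
rewrite -sum1_card (reindex _ (onW_bij _ cons_bij)) big_mkcond /=.
rewrite -(pair_big xpredT xpredT (fun w (t : k.-tuple T) =>
  if [tuple of w :: t] \in walks e k.+1 u v then 1%N else 0%N)) /=.
apply: eq_bigr => w _.
rewrite -sum1_card big_distrr [RHS]big_mkcond /=.
by apply: eq_bigr => t _; rewrite !inE /=; case: (e u w); case: ifP.
Qed.

Lemma card_walksE (R : pzSemiRingType) (n : nat) (e : rel 'I_n) (k : nat)
    (u v : 'I_n) :
  #|walks e k u v|%:R = (adjmx R e ^+ k) u v.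
Proof.
elim: k u => [|k IHk] u.
  rewrite expr0 mxE -sum1_card big_mkcond (big_pred1 [tuple]) => [|t].
    by rewrite inE /=; case: (u == v).
  by rewrite /= [t]tuple0; apply/esym/eqP.
rewrite card_walksS exprS mxE natr_sum.
by apply: eq_bigr => w _; rewrite natrM IHk mxE.
Qed.

(** Exactness of the division follows by induction on [n]: [k!] is a binomial coefficient times
    [(l ord0)!] times [m!], and the remaining factorials divide [m!]. *)
Lemma multinomial_fact (n k : nat) (l : 'I_n -> nat) :
  (\sum_(i < n) l i)%N = k ->
  (multinomial k l * \prod_(i < n) (l i)`!)%N = k`!.
Proof.
move=> sum_l; rewrite /multinomial divnK //.
elim: n k l sum_l => [|n IHn] k l; first by rewrite !big_ord0 dvd1n.
rewrite big_ord_recl => <-; set m := (\sum_(i < n) _)%N.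
rewrite big_ord_recl -(bin_fact (leq_addr m (l ord0))) addKn.
by rewrite dvdn_mull // dvdn_mul // IHn.
Qed.

(** Multiplying both sides by all the factorials turns each into [k!], which avoids computing with
    truncated division. *)
Lemma multinomialS (n k : nat) (l : 'I_n.+1 -> nat) :
  (\sum_(i < n.+1) l i)%N = k ->
  multinomial k l =
    ('C(k, l ord0) * multinomial (k - l ord0) (fun i => l (lift ord0 i)))%N.
Proof.
move=> sum_l; have sum_l' : (\sum_(i < n) l (lift ord0 i) = k - l ord0)%N.
  by rewrite -sum_l big_ord_recl addKn.
have le_lk : (l ord0 <= k)%N by rewrite -sum_l big_ord_recl leq_addr.
have P_gt0 : (0 < \prod_(i < n.+1) (l i)`!)%N.
  by rewrite prodn_gt0 // => i; rewrite fact_gt0.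
apply/eqP; rewrite -(eqn_pmul2r P_gt0) multinomial_fact //; apply/eqP.
by rewrite big_ord_recl mulnACA multinomial_fact // -mulnA bin_fact.
Qed.

(** Splitting off the first exponent permits induction on the number of variables in the multinomial
    theorem. *)
Lemma big_ffun_recl (R : Type) (idx : R) (op : Monoid.com_law idx)
    (T : finType) (n : nat) (P : pred {ffun 'I_n.+1 -> T})
    (F : {ffun 'I_n.+1 -> T} -> R) :
  let cons a f := [ffun i => oapp (fun j => f j) a (unlift ord0 i)] in
  \big[op/idx]_(l | P l) F l =
  \big[op/idx]_(a : T)
    \big[op/idx]_(f : {ffun 'I_n -> T} | P (cons a f)) F (cons a f).
Proof.
move=> cons; rewrite pair_big_dep /=; apply: reindex; apply: onW_bij.
exists (fun l : {ffun 'I_n.+1 -> T} => (l ord0, [ffun i => l (lift ord0 i)])).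
  case=> a f; rewrite /cons ffunE unlift_none /=; congr pair.
  by apply/ffunP => i; rewrite !ffunE liftK.
move=> l; apply/ffunP => i; rewrite ffunE.
by case: unliftP => [j|] -> /=; rewrite ?ffunE.
Qed.

(* The exponents are bounded by an arbitrary m >= k because the induction on n
   lowers k while the index type has to stay the same. *)
Lemma multinomial_expansion (R : comPzSemiRingType) (n k m : nat)
    (x : 'I_n -> R) :
  (k <= m)%N ->
  (\sum_(i < n) x i) ^+ k =
  \sum_(l : {ffun 'I_n -> 'I_m.+1} | (\sum_(i < n) l i)%N == k)
    (multinomial k (fun i => l i : nat))%:R * \prod_(i < n) x i ^+ l i.
Proof.
elim: n k x => [|n IHn] k x le_km.
  rewrite big_ord0 expr0n.
  pose l0 : {ffun 'I_0 -> 'I_m.+1} := [ffun=> ord0].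
  rewrite big_mkcond (big_pred1 l0); last first.
    by move=> l; apply/esym/eqP/ffunP; case.
  rewrite !big_ord0 eq_sym; case: eqP => [<-|_] //.
  by rewrite /multinomial big_ord0 mulr1.
rewrite big_ffun_recl big_ord_recl addrC exprDn.
(* The binomial sum over [a <= k] is padded with zeros up to [m], the range of the first exponent;
   for [a > k] no exponent vector on the other side has sum [k]. *)
rewrite (big_ord_widen m.+1 (fun a =>
  (\sum_(i < n) x (lift ord0 i)) ^+ (k - a) * x ord0 ^+ a *+ 'C(k, a))) //.
rewrite big_mkcond /=; apply: eq_bigr => a _; case: ifPn => [lt_ak|]; last first.
  rewrite ltnS => le_ka; rewrite big_pred0 // => f; apply/negP.
  rewrite big_ord_recl ffunE unlift_none /= => /eqP sum_k; move: le_ka.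
  by rewrite -sum_k leq_addr.
rewrite ltnS in lt_ak.
rewrite (IHn _ _ (leq_trans (leq_subr _ _) le_km)) big_distrl -sumrMnl /=.
have consE (f : {ffun 'I_n -> 'I_m.+1}) i :
    [ffun i0 => oapp (fun j => f j) a (unlift ord0 i0)] (lift ord0 i) = f i.
  by rewrite ffunE liftK.
have cons0 (f : {ffun 'I_n -> 'I_m.+1}) :
    [ffun i0 => oapp (fun j => f j) a (unlift ord0 i0)] ord0 = a.
  by rewrite ffunE unlift_none.
have sumE (f : {ffun 'I_n -> 'I_m.+1}) :
    (\sum_(i < n.+1) [ffun i0 => oapp (fun j => f j) a (unlift ord0 i0)] i =
     a + \sum_(i < n) f i)%N.
  by rewrite big_ord_recl cons0; under eq_bigr do rewrite consE.
apply: eq_big => [f|f /eqP sum_f].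
  by rewrite sumE -(eqn_add2l a) subnKC.
rewrite multinomialS ?sumE ?sum_f ?subnKC // cons0 big_ord_recl cons0.
under [in RHS]eq_bigr do rewrite consE.
rewrite -[_ *+ 'C(k, a)]mulr_natl natrM [_ * x ord0 ^+ a]mulrC.
rewrite [x ord0 ^+ a * (_ * _)]mulrCA !mulrA; congr (_ * _%:R * _ * _).
by congr (_ %/ _)%N; apply: eq_bigr => i _; rewrite consE.
Qed.

Lemma exprz_natB (F : fieldType) (z : F) (w c b : nat) : z != 0 ->
  z ^ ((w%:Z - c%:Z) * b%:Z) = z ^+ (w * b) / z ^+ (c * b).
Proof. by move=> z_neq0; rewrite mulrBl expfzDr // -!PoszM -exprnN. Qed.

Lemma prim_root_neq0 (F : fieldType) (n : nat) (z : F) :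
  n.-primitive_root z -> z != 0.
Proof.
move=> z_prim; apply: contra_eq_neq (prim_expr_order z_prim) => ->.
by rewrite expr0n gtn_eqF ?(prim_order_gt0 z_prim) // eq_sym oner_neq0.
Qed.

(** This is a geometric series with ratio [q = z ^+ w / z ^+ c]. If [q = 1], every term is 1;
    otherwise [q - 1] times the sum is [q ^+ n - 1 = 0]. *)
Lemma prim_root_orthogonality (F : fieldType) (n : nat) (z : F) (w c : nat) :
  n.-primitive_root z ->
  \sum_(b < n) z ^ ((w%:Z - c%:Z) * b%:Z) =
    n%:R * (w == c %[mod n])%:R.
Proof.
move=> z_prim; have z_neq0 := prim_root_neq0 z_prim.
have zc_neq0 : z ^+ c != 0 by rewrite expf_neq0.
have -> : \sum_(b < n) z ^ ((w%:Z - c%:Z) * b%:Z) =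
          \sum_(b < n) (z ^+ w / z ^+ c) ^+ b.
  by apply: eq_bigr => b _; rewrite exprz_natB // expr_div_n -!exprM.
rewrite -(eq_prim_root_expr z_prim); have [zE|z_neq] := eqVneq.
  rewrite zE divff // mulr1; under eq_bigr do rewrite expr1n.
  by rewrite sumr_const card_ord.
rewrite mulr0; apply: (@mulfI _ (z ^+ w / z ^+ c - 1)).
  by rewrite subr_eq0 -(inj_eq (mulIf zc_neq0)) divfK // mul1r.
rewrite mulr0 -subrX1 expr_div_n -!exprM ![(_ * n)%N]mulnC !exprM.
by rewrite (prim_expr_order z_prim) !expr1n divr1 subrr.
Qed.

(** The graph is a Cayley graph: translating by [u] reduces the sum to the six distinct residues. *)
Lemma sum_paley13 (R : pzSemiRingType) (u : 'Z_13) (F : 'Z_13 -> R) :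
  \sum_w (paley13 u w)%:R * F w =
  \sum_(i < 6) F (u + inZp (tnth residues13 i)).
Proof.
rewrite (reindex_inj (addrI u)) /=.
under eq_bigr do rewrite paley13E addrAC subrr add0r.
rewrite -(big_tuple _ _ residues13 xpredT (fun r => F (u + inZp r))).
rewrite -(big_map (@inZp 12) xpredT (fun d => F (u + d))) [RHS]big_uniq //.
rewrite [RHS]big_mkcond /=; apply: eq_bigr => d _.
have -> : (val d \in (residues13 : seq nat)) =
          (d \in map (@inZp 12) residues13).
  by case: d => -[|[|[|[|[|[|[|[|[|[|[|[|[|m]]]]]]]]]]]]].
by case: ifP; rewrite ?mul1r ?mul0r.
Qed.

(** The start [u] is arbitrary because the induction on [k] moves it: a step by a residue [r]
    multiplies the [b]-th term by [z ^+ (r * b)], and summing over [r] gives one more eigenvalue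
    factor. The case [k = 0] is orthogonality. *)
Lemma paley13_powE (F : fieldType) (z : F) (k : nat) (u c : 'I_13) :
  13.-primitive_root z -> 13%:R != 0 :> F ->
  (adjmx F paley13 ^+ k) u c =
  13%:R^-1 * \sum_(b < 13) z ^ ((u%:Z - c%:Z) * b%:Z) *
               (\sum_(i < 6) z ^+ (tnth residues13 i * b)) ^+ k.
Proof.
move=> z_prim nz13; have z_neq0 := prim_root_neq0 z_prim.
elim: k u => [|k IHk] u.
  under eq_bigr do rewrite expr0 mulr1.
  by rewrite prim_root_orthogonality // mulKf // expr0 mxE !modn_small.
rewrite exprS mxE; under eq_bigr do rewrite mxE.
rewrite (sum_paley13 u (fun w => (adjmx F paley13 ^+ k) w c)).
under eq_bigr do rewrite IHk; rewrite -mulr_sumr exchange_big /=.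
congr (_ * _); apply: eq_bigr => b _.
rewrite -mulr_suml exprS mulrA; congr (_ * _); rewrite mulr_sumr.
apply: eq_bigr => i _; rewrite !exprz_natB // mulrAC -exprD -mulnDl.
(* Addition in ['Z_13] reduces modulo 13, so the two exponents are only congruent, which suffices
   for a 13th root of unity. *)
congr (_ / _); apply/eqP; rewrite (eq_prim_root_expr z_prim) /=.
by rewrite -[(Zp_trunc 13).+2]/13%N -modnMml modn_mod modnDmr modnMml.
Qed.

Theorem corollary3p4 (R : realType) (omega : R[i])
    (omega_prim : 13.-primitive_root omega) (k : nat) (c : 'I_13) :
  let A : 'M[R[i]]_13 := adjmx R[i] paley13 in
  [/\ #|walks paley13 k 0 c|%:R = (A ^+ k) 0 c,
      (A ^+ k) 0 c =
        13%:R^-1 *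
        \sum_(l : {ffun 'I_6 -> 'I_k.+1} | (\sum_(i < 6) l i)%N == k)
          (multinomial k (fun i => l i : nat))%:R *
          (\sum_(b < 13)
             omega ^ (((weight13 (fun i => l i : nat))%:Z - c%:Z) * b%:Z))
    & 13%:R^-1 *
        \sum_(l : {ffun 'I_6 -> 'I_k.+1} | (\sum_(i < 6) l i)%N == k)
          (multinomial k (fun i => l i : nat))%:R *
          (\sum_(b < 13)
             omega ^ (((weight13 (fun i => l i : nat))%:Z - c%:Z) * b%:Z)) =
      (\sum_(l : {ffun 'I_6 -> 'I_k.+1} |
             ((\sum_(i < 6) l i)%N == k) &&
             (weight13 (fun i => l i : nat) == c %[mod 13])%N)
         multinomial k (fun i => l i : nat))%N%:R].
Proof.
move=> A; have z_neq0 := prim_root_neq0 omega_prim.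
have nz13 : 13%:R != 0 :> R[i] by rewrite Num.Theory.pnatr_eq0.
split; first exact: card_walksE.
- rewrite (paley13_powE _ _ _ omega_prim) //; congr (_ * _).
  under eq_bigr do
    rewrite (multinomial_expansion _ (leqnn k)) mulr_sumr.
  rewrite exchange_big; apply: eq_bigr => l _; rewrite mulr_sumr.
  apply: eq_bigr => b _; rewrite mulrCA; congr (_ * _).
  rewrite !exprz_natB // mul0n expr0 mulrAC mul1r; congr (_ / _).
  rewrite /weight13 big_distrl /= expr_sum.
  by apply: eq_bigr => i _; rewrite -exprM mulnAC.
(* Orthogonality makes each inner sum 13 or 0 according to the congruence, and the 13 cancels the
   prefactor. *)
rewrite mulr_sumr natr_sum [RHS]big_mkcondr /=; apply: eq_bigr => l _.
rewrite prim_root_orthogonality // mulrCA mulKf //.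
by case: ifP => _; rewrite ?mulr1 ?mulr0.
Qed.
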